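(* The set $\mathfrak{X}_{\mathfrak{u}(2)}$ of all complex structures on $\mathfrak{u}(2)$ consists exactly of the matrices $$\begin{pmatrix} (a^1_4)^2c^2\xi & (a^3_4+a^2_4a^1_4c\xi)c & (a^3_4a^1_4c\xi-a^2_4)c & a^1_4\\ -(a^3_4-a^2_4a^1_4c\xi)c & (a^2_4)^2c^2\xi & (a^3_4a^2_4c\xi+a^1_4)c & a^2_4\\ (a^3_4a^1_4c\xi+a^2_4)c & (a^3_4a^2_4c\xi-a^1_4)c & (a^3_4)^2c^2\xi & a^3_4\\ -(\xi^2+1)c^2a^1_4 & -(\xi^2+1)c^2a^2_4 & -(\xi^2+1)c^2a^3_4 & -\xi \end{pmatrix}$$ with $$\xi\in\mathbb{R},\qquad \begin{pmatrix} a^1_4 \\ a^2_4 \\ a^3_4 \end{pmatrix}\in\mathbb{R}^3\setminus\{0\},\qquad c=\pm\left((a^1_4)^2+(a^2_4)^2+(a^3_4)^2\right)^{-1/2}.$$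
   Context: $\mathfrak{u}(2)=\mathfrak{su}(2)\oplus\mathbb{R}J_4$ is the real Lie algebra with basis $(J_1,J_2,J_3,J_4)$, where $[J_1,J_2]=J_3$, $[J_2,J_3]=J_1$, $[J_3,J_1]=J_2$ and $J_4$ is central. Linear maps are identified with their matrices in this basis (columns are images of basis vectors); in $a^i_j$, $i$ is the row index and $j$ the column index (upper indices are not exponents). A complex structure on a real Lie algebra $\mathfrak{g}$ is a linear map $J:\mathfrak{g}\to\mathfrak{g}$ with $J^2=-1$ and $[JX,JY]-[X,Y]-J[JX,Y]-J[X,JY]=0$ for all $X,Y\in\mathfrak{g}$. *)

(* Defs.v *)
From HB Require Import structures.
From mathcomp Require Import all_boot all_order all_algebra.
From mathcomp Require Import ring.
From mathcomp Require Import classical_sets reals.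

Set Implicit Arguments.
Unset Strict Implicit.
Unset Printing Implicit Defensive.
Import GRing.Theory Num.Theory.
Local Open Scope ring_scope.

Record lie_algebra (K : fieldType) := LieAlgebra {
  lie_sort :> lmodType K;
  lie_bracket : lie_sort -> lie_sort -> lie_sort;
  lie_bracket_linearl : forall Y, linear (lie_bracket^~ Y);
  lie_bracket_linearr : forall X, linear (lie_bracket X);
  lie_bracket_alt : forall X, lie_bracket X X = 0;
  lie_bracket_jacobi : forall X Y Z,
    lie_bracket X (lie_bracket Y Z) + lie_bracket Y (lie_bracket Z X)
      + lie_bracket Z (lie_bracket X Y) = 0 }.

Reserved Notation "[Lie X , Y ]" (at level 0, X, Y at level 99,
  format "[Lie  X ,  Y ]").
Notation "[Lie X , Y ]" := (lie_bracket X Y) : ring_scope.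

Definition complex_structure (K : fieldType) (g : lie_algebra K)
    (J : {linear g -> g}) : Prop :=
  (forall X : g, J (J X) = - X) /\
  (forall X Y : g,
     [Lie J X, J Y] - [Lie X, Y] - J [Lie J X, Y] - J [Lie X, J Y] = 0).

Section U2.
Variable R : realType.

(* Indices are shifted by one: the coordinate along $J_{k+1}$ is [X k 0].
   The bracket is the cross product on the first three coordinates; its values
   on the basis are computed in [u2_J1J2], ..., [u2_J4r] below. *)
Definition u2_bracket (X Y : 'cV[R]_4) : 'cV[R]_4 :=
  \col_(k < 4) [:: X 1 0 * Y 2 0 - X 2 0 * Y 1 0;
                   X 2 0 * Y 0 0 - X 0 0 * Y 2 0;
                   X 0 0 * Y 1 0 - X 1 0 * Y 0 0;
                   0]`_k.

Fact u2_bracket_linearl Y : linear (u2_bracket^~ Y).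
Proof.
move=> a X X'; apply/matrixP=> k l; rewrite !mxE.
by case: k => -[|[|[|[|//]]]] ? /=; ring.
Qed.

Fact u2_bracket_linearr X : linear (u2_bracket X).
Proof.
move=> a Y Y'; apply/matrixP=> k l; rewrite !mxE.
by case: k => -[|[|[|[|//]]]] ? /=; ring.
Qed.

Fact u2_bracket_alt X : u2_bracket X X = 0.
Proof.
apply/matrixP=> k l; rewrite !mxE.
by case: k => -[|[|[|[|//]]]] ? /=; ring.
Qed.

Fact u2_bracket_jacobi X Y Z :
  u2_bracket X (u2_bracket Y Z) + u2_bracket Y (u2_bracket Z X)
    + u2_bracket Z (u2_bracket X Y) = 0.
Proof.
apply/matrixP=> k l; rewrite !mxE.
by case: k => -[|[|[|[|//]]]] ? /=; ring.
Qed.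

Definition u2 : lie_algebra R :=
  @LieAlgebra R 'cV[R]_4 u2_bracket u2_bracket_linearl u2_bracket_linearr
    u2_bracket_alt u2_bracket_jacobi.

Definition J1 : u2 := delta_mx 0 0.
Definition J2 : u2 := delta_mx 1 0.
Definition J3 : u2 := delta_mx 2 0.
Definition J4 : u2 := delta_mx 3 0.

Fact u2_J1J2 : [Lie J1, J2] = J3.
Proof.
apply/matrixP=> k l; rewrite !mxE ord1 /=.
by case: k => -[|[|[|[|//]]]] ? /=; ring.
Qed.

Fact u2_J2J3 : [Lie J2, J3] = J1.
Proof.
apply/matrixP=> k l; rewrite !mxE ord1 /=.
by case: k => -[|[|[|[|//]]]] ? /=; ring.
Qed.

Fact u2_J3J1 : [Lie J3, J1] = J2.
Proof.
apply/matrixP=> k l; rewrite !mxE ord1 /=.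
by case: k => -[|[|[|[|//]]]] ? /=; ring.
Qed.

Fact u2_J4l X : [Lie J4, X] = 0.
Proof.
apply/matrixP=> k l; rewrite !mxE /=.
by case: k => -[|[|[|[|//]]]] ? /=; ring.
Qed.

Fact u2_J4r X : [Lie X, J4] = 0.
Proof.
apply/matrixP=> k l; rewrite !mxE /=.
by case: k => -[|[|[|[|//]]]] ? /=; ring.
Qed.

(* Linear endomorphisms are identified with their matrices in the basis
   $(J_1, J_2, J_3, J_4)$, acting on column vectors. *)
Definition u2_complex_structures : set 'M[R]_4 :=
  [set M | complex_structure (mulmx M : {linear u2 -> u2})].

(* [aij] stands for $a^i_j$: row [i], column [j]. *)
Definition u2_matrix (xi a14 a24 a34 c : R) : 'M[R]_4 :=
  \matrix_(i < 4, j < 4)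
   (nth [::]
     [:: [:: a14 ^+ 2 * c ^+ 2 * xi;
             (a34 + a24 * a14 * c * xi) * c;
             (a34 * a14 * c * xi - a24) * c;
             a14];
         [:: - (a34 - a24 * a14 * c * xi) * c;
             a24 ^+ 2 * c ^+ 2 * xi;
             (a34 * a24 * c * xi + a14) * c;
             a24];
         [:: (a34 * a14 * c * xi + a24) * c;
             (a34 * a24 * c * xi - a14) * c;
             a34 ^+ 2 * c ^+ 2 * xi;
             a34];
         [:: - (xi ^+ 2 + 1) * c ^+ 2 * a14;
             - (xi ^+ 2 + 1) * c ^+ 2 * a24;
             - (xi ^+ 2 + 1) * c ^+ 2 * a34;
             - xi]] i)`_j.

End U2.

Arguments u2_complex_structures : clear implicits.

(* Main.v *)
(** Write [M] in blocks [A, v; w, -xi] along su(2) + R J_4, and let [K] be the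
    matrix of the cross product by [v] and [n = |v|^2]. The torsion identity at [(X, J_4)]
    says that [A] commutes with [K] and that [w K = 0]; [M^2 = -1] gives
    [A v = xi v] and [w v = -(xi^2 + 1)], so that [v <> 0] and [w] is a
    determined multiple of [v^T]. A matrix
    commuting with [K] acts on the plane orthogonal to [v] as [a + b K], and
    there [A^2 = -1] and [K^2 = -n], which forces [a = 0] and [b^2 n = 1].
    Conversely, for [c^2 n = 1] the two axioms are polynomial identities modulo
    this relation. *)
Require Import Defs.
From HB Require Import structures.
From mathcomp Require Import all_boot all_order all_algebra.
From mathcomp Require Import ring.
From mathcomp Require Import classical_sets reals.

Set Implicit Arguments.
Unset Strict Implicit.
Unset Printing Implicit Defensive.
Import GRing.Theory Num.Theory.
Local Open Scope classical_set_scope.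
Local Open Scope ring_scope.

(** * Enumeration of small index types *)

Lemma ord4_ind (P : 'I_4 -> Prop) : P 0 -> P 1 -> P 2 -> P 3 -> forall k, P k.
Proof.
move=> P0 P1 P2 P3 [[|[|[|[|//]]]] lk].
- by rewrite (_ : Ordinal lk = 0) //; apply: val_inj.
- by rewrite (_ : Ordinal lk = 1) //; apply: val_inj.
- by rewrite (_ : Ordinal lk = 2) //; apply: val_inj.
- by rewrite (_ : Ordinal lk = 3) //; apply: val_inj.
Qed.

Lemma sum_ord4 (V : nmodType) (F : 'I_4 -> V) :
  \sum_k F k = F 0 + F 1 + F 2 + F 3.
Proof.
rewrite !big_ord_recl big_ord0 addr0 !addrA.
by congr (_ + F _ + F _ + F _); apply: val_inj.
Qed.

Lemma ord3_ind (P : 'I_3 -> Prop) : P 0 -> P 1 -> P 2 -> forall k, P k.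
Proof.
move=> P0 P1 P2 [[|[|[|//]]] lk].
- by rewrite (_ : Ordinal lk = 0) //; apply: val_inj.
- by rewrite (_ : Ordinal lk = 1) //; apply: val_inj.
- by rewrite (_ : Ordinal lk = 2) //; apply: val_inj.
Qed.

Lemma sum_ord3 (V : nmodType) (F : 'I_3 -> V) : \sum_k F k = F 0 + F 1 + F 2.
Proof.
rewrite !big_ord_recl big_ord0 addr0 !addrA.
by congr (_ + F _ + F _); apply: val_inj.
Qed.

(** * The cross product matrix, that is [ad v] on su(2), and its invariants *)

Definition cross_mx (R : nzRingType) (v : 'cV[R]_3) : 'M[R]_3 :=
  \matrix_(i, j)
   (nth [::]
     [:: [:: 0; - v 2 0; v 1 0];
         [:: v 2 0; 0; - v 0 0];
         [:: - v 1 0; v 0 0; 0]] i)`_j.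

Definition norm2 (R : nzRingType) (v : 'cV[R]_3) : R :=
  v 0 0 ^+ 2 + v 1 0 ^+ 2 + v 2 0 ^+ 2.

Lemma mul_cross_mx_self (R : comNzRingType) (v : 'cV[R]_3) :
  cross_mx v *m v = 0.
Proof.
apply/matrixP=> k l; rewrite !(mxE, ord1, sum_ord3) /=.
by move: k; apply: ord3_ind => /=; ring.
Qed.

Lemma tr_cross_mx (R : comNzRingType) (v : 'cV[R]_3) :
  (cross_mx v)^T = - cross_mx v.
Proof.
apply/matrixP; apply: ord3_ind; apply: ord3_ind; rewrite !mxE /=; ring.
Qed.

Lemma cross_mx_sqr (R : comNzRingType) (v : 'cV[R]_3) :
  cross_mx v *m cross_mx v = v *m v^T - (norm2 v)%:M.
Proof.
apply/matrixP; apply: ord3_ind; apply: ord3_ind;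
  rewrite !(mxE, sum_ord3, big_ord1) /= /norm2; ring.
Qed.

Lemma tr_mul_self (R : comNzRingType) (v : 'cV[R]_3) :
  v^T *m v = (norm2 v)%:M.
Proof.
by apply/matrixP=> k l; rewrite !ord1 !(mxE, sum_ord3) /= /norm2; ring.
Qed.

Lemma mxtrace_cross_sqr (R : comNzRingType) (v : 'cV[R]_3) :
  \tr (cross_mx v *m cross_mx v) = - 2 * norm2 v.
Proof.
by rewrite /mxtrace !(sum_ord3, mxE) /= /norm2; ring.
Qed.

(* The polarization of Cayley-Hamilton at (K, K, A), where [\tr K = 0],
   [\tr K^2 = - 2 |v|^2] and the adjugate of [K] is [v v^T]. It determines [A]
   once [A] commutes with [K]. *)
Lemma polarized_Cayley_Hamilton (R : comNzRingType) (v : 'cV[R]_3)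
    (K := cross_mx v) (A : 'M[R]_3) :
  K *m K *m A + K *m A *m K + A *m K *m K + norm2 v *: A =
  \tr A *: (K *m K) + \tr (K *m A) *: K + ((v^T *m A *m v) 0 0)%:M.
Proof.
apply/matrixP=> i j; rewrite /K /mxtrace !(mxE, sum_ord3).
by move: i j; apply: ord3_ind; apply: ord3_ind; rewrite /= /norm2; ring.
Qed.

(** All of this is rational in the entries: [c] comes from a trace, not from a square root. The
    order on [F] serves to exclude [xi ^+ 2 + 1 = 0] and [a ^+ 2 + 1 = 0]. *)
Lemma block_complex_structure_solve (F : realFieldType) (A : 'M[F]_3)
    (v : 'cV[F]_3) (w : 'rV[F]_3) (xi : F) (K := cross_mx v) (n := norm2 v) :
    K *m A = A *m K -> w *m K = 0 ->
    A *m A + v *m w = - 1%:M -> A *m v = xi *: v ->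
    w *m v = (- (xi ^+ 2 + 1))%:M ->
  exists c, [/\ c ^+ 2 * n = 1,
    A = (xi * c ^+ 2) *: (v *m v^T) - c *: K &
    w = (- (xi ^+ 2 + 1) * c ^+ 2) *: v^T].
Proof.
move=> KA wK AA Av wv.
have Kv : K *m v = 0 by exact: mul_cross_mx_self.
have vK : v^T *m K = 0.
  by apply: trmx_inj; rewrite trmx_mul trmxK tr_cross_mx mulNmx Kv oppr0 trmx0.
have KK : K *m K = v *m v^T - n%:M by exact: cross_mx_sqr.
have d0 : - (xi ^+ 2 + 1) != 0.
  by rewrite oppr_eq0 lt0r_neq0 // ltr_wpDl ?sqr_ge0.
have nw : n *: w = (- (xi ^+ 2 + 1)) *: v^T.
  have : w *m (K *m K) = 0 by rewrite mulmxA wK mul0mx.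
  rewrite KK mulmxBr mulmxA wv mul_scalar_mx mul_mx_scalar.
  by move/eqP; rewrite subr_eq0 => /eqP.
have n0 : n != 0.
  apply/eqP=> n0; move: nw; rewrite n0 scale0r => /esym/eqP.
  rewrite scaler_eq0 (negPf d0) /= trmx_eq0 => /eqP v0.
  move: wv; rewrite v0 mulmx0 => /matrixP/(_ 0 0)/eqP.
  by rewrite !mxE eq_sym eqxx mulr1n (negPf d0).
(* Traces force these values: [A] should be [xi] on [v] and [a + b K] on the plane orthogonal to
   [v], so [t = xi + 2 a], and [p = b \tr (K *m K) = - 2 n b]. *)
pose t := \tr A; pose p := \tr (K *m A).
pose a := (t - xi) / 2; pose b := - p / (2 * n).
have eA : A = a%:M + ((xi - a) / n) *: (v *m v^T) + b *: K.
  have := polarized_Cayley_Hamilton v A; rewrite /= -/K => H.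
  rewrite -/n -/t -/p KA -[A *m K *m K]mulmxA in H.
  rewrite (_ : K *m K *m A = A *m (K *m K)) in H; last first.
    by rewrite -mulmxA KA mulmxA KA mulmxA.
  rewrite KK mulmxBr mulmxA Av -scalemxAl mul_mx_scalar in H.
  rewrite -[v^T *m A *m v]mulmxA Av -scalemxAr tr_mul_self -/n in H.
  apply/matrixP=> i j; move/matrixP/(_ i j): H.
  rewrite /a /b; clearbody K n t p; move: (v *m v^T) => P.
  rewrite !mxE mulr1n -[n *+ _]mulr_natr -[xi * n *+ _]mulr_natr.
  rewrite -[(t - xi) / 2 *+ _]mulr_natr.
  move: (_ == _)%:R => d H.
  (* After commutation the polarized identity reads [3 A K^2 + n A = t K^2 + p K + xi n]. With
     [K^2 = P - n] and [A P = xi P] it becomes linear in [A], with coefficient [- 2 n]; this is its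
     solution. *)
  transitivity ((3 * xi * P i j -
    (t * (P i j - n * d) + p * K i j + xi * n * d)) / (2 * n)).
    by rewrite -H; field.
  by field.
have AK : A *m K = a *: K + b *: (K *m K).
  rewrite {1}eA !mulmxDl mul_scalar_mx -!scalemxAl -mulmxA.
  by rewrite vK mulmx0 scaler0 addr0.
have KKK : K *m K *m K = - n *: K.
  rewrite {1}KK mulmxBl -mulmxA mul_scalar_mx.
  by rewrite vK mulmx0 sub0r scaleNr.
have E : (a ^+ 2 - b ^+ 2 * n + 1) *: K + (2 * a * b) *: (K *m K) = 0.
  (* As [w K = 0], the term [v w] of [AA] vanishes after multiplication by [K]. Expanding the left
     side by [AK] and [KKK] then gives [E]. *)
  have : A *m (A *m K) = - K.
    rewrite mulmxA; move/(canRL (addrK _)): AA => ->.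
    by rewrite mulmxBl -mulmxA wK mulmx0 subr0 mulNmx mul1mx.
  rewrite {1}AK mulmxDr -!scalemxAr mulmxA AK mulmxDl -!scalemxAl KKK.
  move=> /eqP; rewrite -addr_eq0 => /eqP <-.
  move: (K *m K) => K2; clearbody K a b n; apply/matrixP=> i j; rewrite !mxE.
  by ring.
have trK : \tr K = 0 by rewrite /mxtrace sum_ord3 !mxE /= !addr0.
have trKK : \tr (K *m K) = - 2 * n by exact: mxtrace_cross_sqr.
have n20 : - 2 * n != 0 by rewrite mulf_neq0 // oppr_eq0 pnatr_eq0.
(* The trace of [E] isolates the coefficient of [K^2], because [\tr K = 0] and [\tr K^2] is nonzero.
   Multiplying by [K] first isolates that of [K]. *)
have ab : a * b = 0.
  have /(congr1 mxtrace)/eqP := E.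
  rewrite linearD !linearZ /= trK mulr0 add0r mxtrace0 trKK.
  by rewrite mulf_eq0 (negPf n20) orbF -mulrA mulf_eq0 pnatr_eq0 => /eqP.
have ab1 : a ^+ 2 - b ^+ 2 * n + 1 = 0.
  have /(congr1 (fun X => \tr (K *m X)))/eqP := E.
  rewrite -mulrA ab mulr0 scale0r addr0 -scalemxAr linearZ /= mulmx0 mxtrace0 trKK.
  by rewrite mulf_eq0 (negPf n20) orbF => /eqP.
have a0 : a = 0.
  apply/eqP; move/eqP: ab; rewrite mulf_eq0 => /orP[//|/eqP b0].
  have /eqP[] : a ^+ 2 + 1 != 0 by rewrite lt0r_neq0 // ltr_wpDl ?sqr_ge0.
  by rewrite -ab1 b0 expr0n /= mul0r subr0.
have bn : b ^+ 2 * n = 1.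
  by move: ab1; rewrite a0 expr0n sub0r addrC => /eqP; rewrite subr_eq0 => /eqP.
have b2 : b ^+ 2 = n^-1 by rewrite -[RHS]mul1r -bn mulfK.
(* The sign is that of the block [- c *: K]; with [a = 0] the coefficient of [v v^T] is
   [xi / n = xi c^2]. *)
exists (- b); rewrite sqrrN b2 mulVf //; split=> //.
  by rewrite {1}eA a0 raddf0 add0r subr0 scaleNr opprK.
by apply: (scalerI n0); rewrite nw scalerA mulrCA mulfV // mulr1.
Qed.

(** * The bracket and the matrices of u(2) in blocks of size 3 + 1 *)

Lemma lshift_ord3 : (lshift 1 (0 : 'I_3) = 0 :> 'I_4) *
  (lshift 1 (1 : 'I_3) = 1 :> 'I_4) * (lshift 1 (2 : 'I_3) = 2 :> 'I_4).
Proof. by do !split; apply: val_inj. Qed.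

Lemma u2_bracket_col_mx (R : realType) (x y : 'cV[R]_3) (s t : 'cV[R]_1) :
  u2_bracket (col_mx x s : 'cV_(3 + 1)) (col_mx y t : 'cV_(3 + 1)) =
    col_mx (cross_mx x *m y) 0 :> 'cV_(3 + 1).
Proof.
have E (z : 'cV[R]_3) (r : 'cV[R]_1) k :
  (col_mx z r : 'cV_(3 + 1)) (lshift 1 k) 0 = z k 0 by exact: col_mxEu.
(* These are the six coordinates that the bracket reads, restated at the literal indices of
   ['I_4]. *)
have := (E x s 0, E x s 1, E x s 2, E y t 0, E y t 1, E y t 2).
rewrite !lshift_ord3 => H.
apply/matrixP=> k l; rewrite ord1; case: (split_ordP k) => {}k ->.
  rewrite col_mxEu [LHS]mxE !H !(mxE, sum_ord3) /=.
  by move: k; apply: ord3_ind => /=; ring.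
by rewrite col_mxEd !mxE /= ord1.
Qed.

Lemma u2_matrix_block (R : realType) (v : 'cV[R]_3) (xi c : R) :
  u2_matrix xi (v 0 0) (v 1 0) (v 2 0) c =
    block_mx ((xi * c ^+ 2) *: (v *m v^T) - c *: cross_mx v) v
      ((- (xi ^+ 2 + 1) * c ^+ 2) *: v^T) (- xi)%:M :> 'M_(3 + 1).
Proof.
apply/matrixP=> i j.
case: (split_ordP i) => {}i ->; case: (split_ordP j) => {}j ->.
- rewrite block_mxEul !(mxE, big_ord1); move: i j.
  by apply: ord3_ind; apply: ord3_ind => /=; ring.
- by rewrite block_mxEur mxE ord1; move: i; apply: ord3_ind => /=.
- by rewrite block_mxEdl !mxE ord1; move: j; apply: ord3_ind => /=; ring.
- by rewrite block_mxEdr !mxE !ord1.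
Qed.

Lemma cross_mx_anticomm (R : comNzRingType) (x y : 'cV[R]_3) :
  cross_mx x *m y = - (cross_mx y *m x).
Proof.
apply/matrixP=> k l; rewrite !(mxE, ord1, sum_ord3) /=.
by move: k; apply: ord3_ind => /=; ring.
Qed.

Lemma complex_structure_block (R : realType) (A : 'M[R]_3) (v : 'cV[R]_3)
    (w : 'rV[R]_3) (xi : R) :
  u2_complex_structures R (block_mx A v w (- xi)%:M : 'M_(3 + 1)) ->
  [/\ cross_mx v *m A = A *m cross_mx v, w *m cross_mx v = 0,
    A *m A + v *m w = - 1%:M, A *m v = xi *: v &
    w *m v = (- (xi ^+ 2 + 1))%:M].
Proof.
set M : 'M_(3 + 1) := block_mx _ _ _ _ => -[sqrM torM].
have MM : M *m M = - 1%:M.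
  apply/matrixP=> i j; have /matrixP/(_ i 0) := sqrM (delta_mx j 0).
  by rewrite /= mulmxA -colE [LHS]mxE => ->; rewrite !mxE andbT.
move: MM; rewrite (scalar_mx_block 3 1) /M mulmx_block opp_block_mx oppr0.
case/eq_block_mx => AA Av _ wv.
have tor (x : 'cV[R]_3) : cross_mx v *m (A *m x) = A *m (cross_mx v *m x) /\
             w *m (cross_mx v *m x) = 0.
  (* The second argument is the central [J4], sent to [(v, - xi)]. Only [[M X, M J4] - M [X, M J4] =
     0] survives, that is [(A x) × v = A (x × v)] and [w (x × v) = 0]. *)
  have := torM (col_mx x 0 : 'cV_(3 + 1)) (col_mx 0 1%:M : 'cV_(3 + 1)).
  rewrite /= /M !(@mul_block_col _ 3 1 3 1 1) !mulmx0 !mulmx1 !addr0 !add0r.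
  rewrite /lie_bracket /= !u2_bracket_col_mx !mulmx0 ?(@mul_block_col _ 3 1 3 1 1).
  rewrite !mulmx0 !addr0 !(@opp_col_mx _ 3 1 1) !(@add_col_mx _ 3 1 1).
  (* The zero vector is split as well, so that blocks can be compared. *)
  move=> H; have {}H := etrans H (esym (@col_mx0 R 3 1 1)).
  have [] := @eq_col_mx _ 3 1 1 _ _ _ _ H.
  rewrite !oppr0 !addr0 !add0r (cross_mx_anticomm (A *m x)).
  rewrite (cross_mx_anticomm x) !mulmxN !opprK => /eqP H1 H2.
  by move: H1; rewrite addrC subr_eq0 H2 => /eqP ->.
have torE j (d := delta_mx j 0 : 'cV[R]_3) :
    cross_mx v *m A *m d = A *m cross_mx v *m d /\ w *m cross_mx v *m d = 0.
  by rewrite -!mulmxA; exact: tor.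
split=> //.
- apply/matrixP=> i j; have [/matrixP/(_ i 0) + _] := torE j.
  by rewrite -!colE ![col _ _ _ _]mxE.
- apply/matrixP=> i j; have [_ /matrixP/(_ i 0)] := torE j.
  by rewrite -colE !mxE.
- by apply/eqP; rewrite -subr_eq0 -Av mul_mx_scalar scaleNr.
apply/matrixP=> i j; move/matrixP/(_ i j): wv.
rewrite mul_scalar_mx !ord1 !mxE /= !mulr1n mulrNN => /(canRL (addrK _)) ->.
by rewrite opprD addrC expr2.
Qed.

Lemma u2_matrix_complex (R : realType) (xi a14 a24 a34 c : R) :
  c ^+ 2 * (a14 ^+ 2 + a24 ^+ 2 + a34 ^+ 2) = 1 ->
  u2_complex_structures R (u2_matrix xi a14 a24 a34 c).
Proof.
move=> n1.
(* The relation is solved for a monomial, the shape of equation that [ring: cn] can use for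
   rewriting. *)
have cn : c ^+ 2 * a14 ^+ 2 = 1 - c ^+ 2 * a24 ^+ 2 - c ^+ 2 * a34 ^+ 2.
  by rewrite -n1; ring.
split=> [X|X Y]; apply/matrixP=> k l; rewrite ord1 {l}.
  rewrite !(mxE, sum_ord4) /=.
  by move: k; apply: ord4_ind => /=; ring: cn.
rewrite !(mxE, sum_ord4) /=.
by move: k; apply: ord4_ind => /=; ring: cn.
Qed.

Theorem corollary1 (R : realType) :
  u2_complex_structures R =
  [set M : 'M[R]_4 |
    exists xi a14 a24 a34 c : R,
      [/\ (a14, a24, a34) <> (0, 0, 0),
          c = (Num.sqrt (a14 ^+ 2 + a24 ^+ 2 + a34 ^+ 2))^-1 \/
          c = - (Num.sqrt (a14 ^+ 2 + a24 ^+ 2 + a34 ^+ 2))^-1 &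
          M = u2_matrix xi a14 a24 a34 c]].
Proof.
apply/seteqP; split=> M /=; last first.
  move=> [xi [a14 [a24 [a34 [c [nz cE ->]]]]]].
  set n := a14 ^+ 2 + a24 ^+ 2 + a34 ^+ 2 in cE *.
  have n_ge0 : 0 <= n by rewrite !addr_ge0 ?sqr_ge0.
  have n_neq0 : n != 0.
    apply/eqP=> n0; apply: nz; move/eqP: n0.
    rewrite !paddr_eq0 ?addr_ge0 ?sqr_ge0 // !sqrf_eq0.
    by move=> /andP[/andP[/eqP-> /eqP->] /eqP->].
  apply: u2_matrix_complex.
  by case: cE => ->; rewrite ?sqrrN exprVn sqr_sqrtr // mulVf.
have [A [v [w [xi ->]]]] : exists A (v : 'cV[R]_3) w xi,
    M = block_mx A v w (- xi)%:M :> 'M_(3 + 1).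
  exists (ulsubmx (M : 'M_(3 + 1))), (ursubmx (M : 'M_(3 + 1))).
  exists (dlsubmx (M : 'M_(3 + 1))), (- drsubmx (M : 'M_(3 + 1)) 0 0).
  by rewrite opprK -mx11_scalar submxK.
move=> /complex_structure_block[KA wK AA Av wv].
have [c [cn -> ->]] := block_complex_structure_solve KA wK AA Av wv.
exists xi, (v 0 0), (v 1 0), (v 2 0), c; rewrite u2_matrix_block.
have n_ge0 : 0 <= norm2 v by rewrite !addr_ge0 ?sqr_ge0.
split=> //.
  move=> [v0 v1 v2]; move: cn; rewrite /norm2 v0 v1 v2 expr0n /= !addr0 mulr0.
  by move/esym/eqP; rewrite oner_eq0.
have n_neq0 : norm2 v != 0.
  by apply/eqP=> n0; move/eqP: cn; rewrite n0 mulr0 eq_sym oner_eq0.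
(* Since [norm2 v] is invertible, [c ^+ 2 * norm2 v = 1] fixes [c ^+ 2], hence [c] up to sign. *)
have /eqP : c ^+ 2 = (Num.sqrt (norm2 v))^-1 ^+ 2.
  by apply: (mulIf n_neq0); rewrite cn exprVn sqr_sqrtr // mulVf.
by rewrite eqf_sqr => /orP[] /eqP ->; [left|right].
Qed.
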